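(* Assume $\lambda<\mu_1$ and $\lambda<\mu_2$. Let $x\in\mathbb{R}_+^2$ with $0<x(1)+x(2)<1$ and $x(1)>0$, and set $x_n=\lfloor nx\rfloor$ (componentwise). Then the relative error $$\frac{|P_{x_n}(\tau_n<\tau_0)-P_{x_n}(\tau<\infty)|}{P_{x_n}(\tau_n<\tau_0)}$$ decays exponentially in $n$, i.e. there is $c>0$ such that it is at most $e^{-cn}$ for all sufficiently large $n$.
   Context: Let $\lambda,\mu_1,\mu_2>0$ with $\lambda+\mu_1+\mu_2=1$. Let $I_0,I_1,\dots$ be i.i.d. taking values $(1,0)$, $(-1,1)$, $(0,-1)$ with probabilities $\lambda,\mu_1,\mu_2$ respectively. The two dimensional tandem walk $X$ on $\mathbb{Z}_+^2$ is: $X_{k+1}=X_k+I_k$ if $X_k+I_k\in\mathbb{Z}_+^2$, $X_{k+1}=X_k$ otherwise. The process $\bar X$ on $\mathbb{Z}\times\mathbb{Z}_+$ uses the same $I_k$: $\bar X_{k+1}=\bar X_k+I_k$ if $\bar X_k+I_k\in\mathbb{Z}\times\mathbb{Z}_+$, $\bar X_{k+1}=\bar X_k$ otherwise (so $\bar X$ is constrained only on $\{x(2)=0\}$). Both start from the same point, and $P_x$ denotes the probability when $X_0=\bar X_0=x$. $\tau_n=\inf\{k:X_k(1)+X_k(2)=n\}$, $\tau_0=\inf\{k:X_k=0\}$, $\tau=\inf\{k:\bar X_k(1)+\bar X_k(2)=n\}$ (so $\tau$ depends on $n$). *)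

(* Defs.v *)
From HB Require Import structures.
From mathcomp Require Import all_boot all_order all_algebra.
From mathcomp Require Import all_classical all_reals all_analysis.

Set Implicit Arguments.
Unset Strict Implicit.
Unset Printing Implicit Defensive.

Import Order.TTheory GRing.Theory Num.Theory.
Import numFieldNormedType.Exports.

Local Open Scope classical_set_scope.
Local Open Scope ring_scope.

Definition lattice : Type := (int * int)%type.

Section Increments.
Context (d : measure_display) (Omega : measurableType d) (R : realType).
Variable P : probability Omega R.

(* [lattice] is countable and carries its discrete sigma-algebra, so that a
   random variable is a map for which the preimage of every set is measurable *)
Definition lattice_rv (Z : Omega -> lattice) : Prop :=
  forall A : set lattice, measurable (Z @^-1` A).

Definition mutually_independent (xi : nat -> Omega -> lattice) : Prop :=
  forall (J : seq nat) (A : nat -> set lattice), uniq J ->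
    P (\bigcap_(j in [set` J]) (xi j @^-1` A j)) =
    (\prod_(j <- J) P (xi j @^-1` A j))%E.

Definition tandem_law (lambda mu1 mu2 : R) (Z : Omega -> lattice) : Prop :=
  [/\ P (Z @^-1` [set (1, 0)]) = lambda%:E,
      P (Z @^-1` [set (-1, 1)]) = mu1%:E &
      P (Z @^-1` [set (0, -1)]) = mu2%:E].

(* the three probabilities are meant to add up to 1, in which case [tandem_law]
   determines the common distribution of the increments *)
Definition iid_tandem_increments (lambda mu1 mu2 : R)
    (xi : nat -> Omega -> lattice) : Prop :=
  [/\ forall k, lattice_rv (xi k),
      mutually_independent xi &
      forall k, tandem_law lambda mu1 mu2 (xi k)].

End Increments.

Section Walks.
Variable Omega : Type.

Definition constrained_step (S : set lattice) (y v : lattice) : lattice :=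
  if `[< S (y + v) >] then y + v else y.

Fixpoint constrained_walk (S : set lattice) (xi : nat -> Omega -> lattice)
    (y : lattice) (k : nat) (w : Omega) : lattice :=
  if k is k'.+1 then
    constrained_step S (constrained_walk S xi y k' w) (xi k' w)
  else y.

Definition quadrant : set lattice := [set y | 0 <= y.1 /\ 0 <= y.2].

Definition upper_half_plane : set lattice := [set y | 0 <= y.2].

Definition tandem_walk := constrained_walk quadrant.

Definition tandem_walk_bar := constrained_walk upper_half_plane.

(* the infimum of the empty set is +oo *)
Definition hitting_time (R : realType) (Y : nat -> Omega -> lattice)
    (B : set lattice) (w : Omega) : \bar R :=
  ereal_inf [set (k%:R)%:E | k in [set k : nat | B (Y k w)]].

Definition sum_level (n : nat) : set lattice := [set y | y.1 + y.2 = n%:Z].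

Definition tau_n (R : realType) (xi : nat -> Omega -> lattice) (y : lattice)
    (n : nat) : Omega -> \bar R :=
  hitting_time R (tandem_walk xi y) (sum_level n).

Definition tau_0 (R : realType) (xi : nat -> Omega -> lattice) (y : lattice) :
    Omega -> \bar R :=
  hitting_time R (tandem_walk xi y) [set 0].

Definition tau_bar (R : realType) (xi : nat -> Omega -> lattice) (y : lattice)
    (n : nat) : Omega -> \bar R :=
  hitting_time R (tandem_walk_bar xi y) (sum_level n).

End Walks.

Section ExitProbabilities.
Context (d : measure_display) (Omega : measurableType d) (R : realType).
Variables (P : probability Omega R) (xi : nat -> Omega -> lattice).

(* [P_y] is [P] with both walks started from [y] *)
Definition exit_prob (y : lattice) (n : nat) : R :=
  fine (P [set w | (tau_n R xi y n w < tau_0 R xi y w)%E]).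

Definition exit_prob_bar (y : lattice) (n : nat) : R :=
  fine (P [set w | (tau_bar R xi y n w < +oo)%E]).

Definition relative_error (y : lattice) (n : nat) : R :=
  `|exit_prob y n - exit_prob_bar y n| / exit_prob y n.

End ExitProbabilities.

Definition scaled_start (R : realType) (x : R * R) (n : nat) : lattice :=
  (Num.floor (n%:R * x.1), Num.floor (n%:R * x.2)).

(* Main.v *)
Require Import Defs.
From HB Require Import structures.
From mathcomp Require Import all_boot all_order all_algebra.
From mathcomp Require Import all_classical all_reals all_analysis.
From mathcomp Require Import zify ring lra.

Set Implicit Arguments.
Unset Strict Implicit.
Unset Printing Implicit Defensive.

Import Order.TTheory GRing.Theory Num.Theory.
Import numFieldNormedType.Exports.

Local Open Scope classical_set_scope.
Local Open Scope ring_scope.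

(** Write [v] and [vbar] for the probabilities that the tandem walk reaches the
level [n] before the origin, and that the half-plane walk reaches it at all.

Started together, the two walks coincide until the first queue is empty.  After
that the half-plane walk may serve a customer where the tandem walk cannot; such
a service leaves the sum of the coordinates unchanged, so both walks keep the
same sum, and hence reach level [n] together, until the tandem walk also sees
its second queue empty.  The two events can therefore differ only on paths that
reach the vertical axis, later the horizontal axis, and still climb to level
[n].  Fix [b] with [1 < b < min (mu1, mu2) / lambda].  When the tandem walk is at
[(p, 0)] and both sums are [p], each walk still climbs to level [n] with
probability at most of order [b ^ p / b ^ n].  The visit to the vertical axis
resets the first coordinate to [0], and on the way from there to the horizontal
axis [b ^ p] has a mean at most affine in [n]; so, whatever the starting point,
[`|v - vbar|] is at most an affine function of [n] times [b ^- n]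
([hit_prob_diff_le_linear]).  This is proved with superharmonic functions:
[barrier_half] and [barrier_quadrant] bound [vbar] and [v], and [barrier_axis]
follows the pair of walks between the two axes.

In the other direction, for every [b'] above [min (mu1, mu2) / lambda] one of
the functions [b' ^ y.1] and [b' ^ (y.1 + y.2)] is strictly subharmonic, as in
the gambler's ruin problem, which gives [v >= b' ^- n * (b' ^ y.1 - 1)]
([exit_prob_ge]).  Since [y.1] is at least a fixed proportion of [n], the lower
bound wins over the upper bound exponentially as soon as [b] and [b'] are both
close enough to [min (mu1, mu2) / lambda].

Both walks depend on finitely many increments up to a given time, so the
probability of hitting within [k] steps satisfies the one-step recursion
[hit_prob]; all estimates are made on that recursion, and [k] then tends to
infinity. *)

Local Notation arrival := (((1, 0) : lattice)%R).
Local Notation service1 := (((-1, 1) : lattice)%R).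
Local Notation service2 := (((0, -1) : lattice)%R).

(** * Hitting probabilities within finitely many steps *)

Section Recursion.
Variables (R : realType) (lambda mu1 mu2 : R) (S : set lattice).

Definition mean_step (f : lattice -> R) (y : lattice) : R :=
  lambda * f (constrained_step S y arrival)
  + mu1 * f (constrained_step S y service1)
  + mu2 * f (constrained_step S y service2).

(** With target [B] and taboo set [C], this recursion covers both walks: the
tandem walk stops at the origin, the half-plane walk never does. *)
Fixpoint hit_prob (B C : pred lattice) (k : nat) (y : lattice) : R :=
  if B y then 1 else if C y then 0
  else if k is k'.+1 then mean_step (hit_prob B C k') y else 0.

Lemma hit_probS B C k y : ~~ B y -> ~~ C y ->
  hit_prob B C k.+1 y = mean_step (hit_prob B C k) y.
Proof. by move=> /negbTE By /negbTE Cy; rewrite /= By Cy. Qed.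

End Recursion.

Section HittingEvent.
Variables (Omega : Type) (xi : nat -> Omega -> lattice).
Variables (S : set lattice) (B C : pred lattice).

(** Conditioning on the first increment leaves a walk driven by the later ones;
indexing by [j] keeps those increments part of the same family, so that their
independence from the past remains available. *)
Definition walk_from (j : nat) := constrained_walk S (fun i => xi (j + i)%N).

Definition hits_within (j k : nat) (y : lattice) : set Omega :=
  [set w | exists i, [/\ (i <= k)%N, B (walk_from j y i w) &
    forall l, (l < i)%N -> ~~ C (walk_from j y l w)]].

Lemma walk_fromS j y k w :
  walk_from j y k.+1 w = walk_from j.+1 (constrained_step S y (xi j w)) k w.
Proof.
rewrite /walk_from; elim: k => [|k IH]; first by rewrite /= addn0.
by rewrite [LHS]/= -/(constrained_walk _ _ _ k.+1 w) IH /= addnS addSn.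
Qed.

Lemma hits_within_start j k y : B y -> hits_within j k y = setT.
Proof. by move=> By; apply/seteqP; split => // w _; exists 0%N; split. Qed.

Lemma hits_within_taboo j k y : ~~ B y -> C y -> hits_within j k y = set0.
Proof.
move=> NBy Cy; apply/seteqP; split => // w [[|i] [_ Bi Ci]].
  by move: NBy; rewrite Bi.
by have := Ci 0%N isT; rewrite /= Cy.
Qed.

Lemma hits_within0 j y : ~~ B y -> hits_within j 0 y = set0.
Proof.
move=> NBy; apply/seteqP; split => // w [[|i] [//= _ Bi _]].
by move: NBy; rewrite Bi.
Qed.

Lemma hits_withinS j k y w : ~~ B y -> ~~ C y ->
  hits_within j k.+1 y w <->
  hits_within j.+1 k (constrained_step S y (xi j w)) w.
Proof.
move=> NBy NCy; split.
  move=> [[|i] [ik Bi Ci]]; first by move: NBy; rewrite Bi.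
  exists i; split=> //; first by rewrite -walk_fromS.
  by move=> l li; rewrite -walk_fromS; apply: Ci.
move=> [i [ik Bi Ci]]; exists i.+1; split=> //; first by rewrite walk_fromS.
by move=> [|l] li //; rewrite walk_fromS; apply: Ci.
Qed.

Lemma hits_within_mono j y k k' : (k <= k')%N ->
  hits_within j k y `<=` hits_within j k' y.
Proof. by move=> kk' w [i [ik Bi Ci]]; exists i; split=> //; apply: leq_trans kk'. Qed.

End HittingEvent.

(** * From the increments to the recursion *)

Section Link.
Context (d : measure_display) (Omega : measurableType d) (R : realType).
Variables (P : probability Omega R) (xi : nat -> Omega -> lattice).
Variables (lambda mu1 mu2 : R).
Hypothesis rates_sum : lambda + mu1 + mu2 = 1.
Hypothesis xi_iid : iid_tandem_increments P lambda mu1 mu2 xi.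
Variables (S : set lattice) (B C : pred lattice).

Lemma measurable_hits_within j k y :
  measurable (hits_within xi S B C j k y).
Proof.
elim: k j y => [|k IH] j y.
  have [By|NBy] := boolP (B y); first by rewrite hits_within_start.
  by rewrite hits_within0.
have [By|NBy] := boolP (B y); first by rewrite hits_within_start.
have [Cy|NCy] := boolP (C y); first by rewrite hits_within_taboo.
have -> : hits_within xi S B C j k.+1 y =
    \bigcup_(v : lattice) (xi j @^-1` [set v] `&`
      hits_within xi S B C j.+1 k (constrained_step S y v)).
  apply/seteqP; split => w.
    by move=> /hits_withinS-/(_ NBy NCy) H; exists (xi j w).
  by move=> [v _ [/= <- H]]; apply/hits_withinS.
apply: countable_bigcupT_measurable => [|v]; first exact: countableP.
apply: measurableI => //.
by case: xi_iid => + _ _; exact.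
Qed.

(** The three rates add up to [1], so an increment takes any other value with
probability [0]. *)
Lemma split_first_step j (E : set Omega) : measurable E ->
  P E = (P (E `&` xi j @^-1` [set arrival]) +
         P (E `&` xi j @^-1` [set service1]) +
         P (E `&` xi j @^-1` [set service2]))%E.
Proof.
case: xi_iid => mxi _ /(_ j) [Pa Pb Pc] mE.
have PU F G : measurable F -> measurable G -> F `&` G = set0 ->
  P (F `|` G) = (P F + P G)%E by exact: measureU.
set a := xi j @^-1` [set arrival] in Pa *.
set b := xi j @^-1` [set service1] in Pb *.
set c := xi j @^-1` [set service2] in Pc *.
have ma : measurable a by exact: mxi.
have mb : measurable b by exact: mxi.
have mc : measurable c by exact: mxi.
have ab : a `&` b = set0.
  by apply/seteqP; split => // w []; rewrite /a /b /= => ->.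
have abc : (a `|` b) `&` c = set0.
  by apply/seteqP; split => // w [[]]; rewrite /a /b /c /= => ->.
have P1 : P (a `|` b `|` c) = 1%E.
  rewrite PU //; last exact: measurableU.
  rewrite PU //.
  by rewrite Pa Pb Pc -!EFinD rates_sum.
have P0 : P (~` (a `|` b `|` c)) = 0%E.
  rewrite probability_setC ?P1 ?subee //.
  by apply: measurableU => //; apply: measurableU.
have mabc : measurable (a `|` b `|` c).
  by apply: measurableU => //; apply: measurableU.
have PN : P (E `&` ~` (a `|` b `|` c)) = 0%E.
  apply/eqP; rewrite eq_le measure_ge0 andbT -P0; apply: le_measure.
  - by rewrite inE; apply: measurableI => //; apply: measurableC.
  - by rewrite inE; apply: measurableC.
  - by move=> w [].
rewrite -{1}(setIT E) -(setUv (a `|` b `|` c)) setIUr PU //.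
- rewrite PN adde0 !setIUr PU //.
  + rewrite PU //; try exact: measurableI.
    by apply/seteqP; split => // w [[_ wa] [_ wb]]; rewrite -ab.
  + by apply: measurableU; apply: measurableI.
  + exact: measurableI.
  + apply/seteqP; split => // w [wab [_ wc]]; rewrite -abc; split => //.
    by case: wab => -[_ ?]; [left|right].
- exact: measurableI.
- by apply: measurableI => //; apply: measurableC.
- by apply/seteqP; split => // w [[_ ?] [_]].
Qed.

Definition cylinder (j : nat) (A : nat -> set lattice) : set Omega :=
  \bigcap_(i in [set` iota 0 j]) (xi i @^-1` A i).

Lemma measurable_cylinder j A : measurable (cylinder j A).
Proof.
apply: bigcap_measurableType => i _.
by case: xi_iid => + _ _; exact.
Qed.

Lemma cylinderE j A w :
  cylinder j A w <-> forall i, (i < j)%N -> A i (xi i w).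
Proof.
split=> [H i ij|H i]; first by apply: H; rewrite /mkset mem_iota.
by rewrite /mkset mem_iota => /andP[_]; exact: H.
Qed.

(** Imposing one more increment keeps the event a cylinder, which is what lets
mutual independence apply again in the next step. *)
Lemma cylinderS j A v :
  cylinder j.+1 (fun i => if (i < j)%N then A i else [set v]) =
  cylinder j A `&` xi j @^-1` [set v].
Proof.
apply/seteqP; split => w.
  move=> /cylinderE H; split; last by have := H j (ltnSn j); rewrite ltnn.
  by apply/cylinderE => i ij; have := H i (ltnW ij); rewrite ij.
move=> [/cylinderE H wj]; apply/cylinderE => i.
rewrite ltnS leq_eqVlt => /predU1P[->|ij]; first by rewrite ltnn.
by rewrite ij; apply: H.
Qed.

Lemma cylinderS_prob j A v :
  P (cylinder j A `&` xi j @^-1` [set v]) =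
  (P (cylinder j A) * P (xi j @^-1` [set v]))%E.
Proof.
have [_ ind _] := xi_iid.
rewrite -cylinderS /cylinder !ind ?iota_uniq //.
rewrite -addn1 iotaD big_cat big_seq1 add0n ltnn /=; congr (_ * _)%E.
by apply: eq_big_seq => i; rewrite mem_iota add0n => /andP[_ ->].
Qed.

(** Carrying a cylinder over the past along the induction replaces the Markov
property: each step moves one increment from the future into the cylinder. *)
Lemma prob_hits_within_cylinder j k y A :
  P (cylinder j A `&` hits_within xi S B C j k y) =
  (P (cylinder j A) * (hit_prob lambda mu1 mu2 S B C k y)%:E)%E.
Proof.
elim: k j y A => [|k IH] j y A /=.
  case: ifPn => [By|NBy]; first by rewrite hits_within_start // setIT mule1.
  by rewrite hits_within0 // setI0 measure0 if_same mule0.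
case: ifPn => [By|NBy]; first by rewrite hits_within_start // setIT mule1.
case: ifPn => [Cy|NCy].
  by rewrite hits_within_taboo // setI0 measure0 mule0.
have [_ _ /(_ j) [Pa Pb Pc]] := xi_iid.
have step v : P (cylinder j A `&` hits_within xi S B C j k.+1 y
      `&` xi j @^-1` [set v]) =
    (P (cylinder j A) * P (xi j @^-1` [set v]) *
     (hit_prob lambda mu1 mu2 S B C k (constrained_step S y v))%:E)%E.
  rewrite -cylinderS_prob -cylinderS -IH cylinderS; congr (P _).
  apply/seteqP; split => w.
    by move=> [[cw /hits_withinS-/(_ NBy NCy) hw] /= <-].
  move=> [[cw /= <-] hw]; split => //; split => //.
  exact/hits_withinS.
rewrite (split_first_step j); last first.
  by apply: measurableI; [exact: measurable_cylinder|exact: measurable_hits_within].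
rewrite !step Pa Pb Pc -!muleA -!EFinM -!muleDr ?fin_num_measure -?EFinD //;
  exact: measurable_cylinder.
Qed.

Lemma prob_hits_within k y :
  P (hits_within xi S B C 0 k y) = (hit_prob lambda mu1 mu2 S B C k y)%:E.
Proof.
have := prob_hits_within_cylinder 0 k y (fun=> setT).
have -> : cylinder 0 (fun=> setT) = setT.
  by apply/seteqP; split => // w _; apply/cylinderE.
by rewrite setTI probability_setT mul1e.
Qed.

(** Continuity of [P] along the increasing events of hitting within [k] steps. *)
Lemma hit_prob_cvg y :
  hit_prob lambda mu1 mu2 S B C k y @[k --> \oo] -->
  fine (P (\bigcup_k hits_within xi S B C 0 k y)).
Proof.
have mE k : measurable (hits_within xi S B C 0 k y).
  exact: measurable_hits_within.
have mU : measurable (\bigcup_k hits_within xi S B C 0 k y).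
  exact: bigcupT_measurable.
have -> : hit_prob lambda mu1 mu2 S B C ^~ y =
    (fun k => fine (P (hits_within xi S B C 0 k y))).
  by apply/funext => k; rewrite prob_hits_within.
apply: fine_cvg; rewrite fineK ?fin_num_measure //.
apply: nondecreasing_cvg_mu => // k k' kk'.
by apply/subsetPset; apply: hits_within_mono.
Qed.

End Link.

Section HittingTimes.
Context (Omega : Type) (R : realType).

Lemma hitting_time_lty (Y : nat -> Omega -> lattice) (A : set lattice) w :
  (hitting_time R Y A w < +oo)%E <-> exists k, A (Y k w).
Proof.
split.
  by move=> /ereal_inf_lt[_ [k Ak _] _]; exists k.
move=> [k Ak]; apply: le_lt_trans (ltry k%:R).
by apply: ereal_inf_lbound; exists k.
Qed.

Lemma hitting_time_lt (Y : nat -> Omega -> lattice) (A A' : set lattice) w :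
  (forall y, A y -> ~ A' y) ->
  (hitting_time R Y A w < hitting_time R Y A' w)%E <->
  exists k, A (Y k w) /\ forall l, (l < k)%N -> ~ A' (Y l w).
Proof.
move=> AA'; split.
  move=> /ereal_inf_lt[_ [k Ak <-] lt_k]; exists k; split => // l lk A'l.
  have : (hitting_time R Y A' w <= l%:R%:E)%E by apply: ereal_inf_lbound; exists l.
  by move=> /(lt_le_trans lt_k); rewrite lte_fin ltr_nat ltnNge (ltnW lk).
move=> [k [Ak NA']].
apply: (@le_lt_trans _ _ k%:R%:E); first by apply: ereal_inf_lbound; exists k.
apply: (@lt_le_trans _ _ k.+1%:R%:E); first by rewrite lte_fin ltr_nat.
apply/ereal_infP => _ [l A'l <-]; rewrite lee_fin ler_nat.
rewrite ltnNge leq_eqVlt; apply/negP => /predU1P[lk|lk].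
  by move: A'l; rewrite lk; apply: AA'.
exact: NA' A'l.
Qed.

End HittingTimes.

Definition level (n : nat) : pred lattice := fun y => y.1 + y.2 == n%:Z.

(** * One step of the two walks *)

Section Averages.
Variables (R : realType) (lambda mu1 mu2 : R).
Local Notation mean := (mean_step lambda mu1 mu2).

Lemma step_quadrant_arrival p q : 0 <= p -> 0 <= q ->
  constrained_step quadrant (p, q) arrival = (p + 1, q).
Proof.
move=> p0 q0; rewrite /constrained_step asboolT /=.
  by congr pair; rewrite ?addr0.
by rewrite /quadrant /=; split; lia.
Qed.

Lemma step_quadrant_service1 p q : 0 <= p -> 0 <= q ->
  constrained_step quadrant (p, q) service1 =
  if 0 < p then (p - 1, q + 1) else (p, q).
Proof.
move=> p0 q0; rewrite /constrained_step.
by case: asboolP => /= H; case: ifPn => // H'; exfalso;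
  move: H; rewrite /quadrant /=; lia.
Qed.

Lemma step_quadrant_service2 p q : 0 <= p -> 0 <= q ->
  constrained_step quadrant (p, q) service2 =
  if 0 < q then (p, q - 1) else (p, q).
Proof.
move=> p0 q0; rewrite /constrained_step.
have -> : (p, q) + service2 = (p, q - 1) by congr pair; rewrite /= addr0.
by case: asboolP => /= H; case: ifPn => // H'; exfalso;
  move: H; rewrite /quadrant /=; lia.
Qed.

Lemma step_half_arrival p q : 0 <= q ->
  constrained_step upper_half_plane (p, q) arrival = (p + 1, q).
Proof.
move=> q0; rewrite /constrained_step asboolT /=.
  by congr pair; rewrite ?addr0.
by rewrite /upper_half_plane /=; lia.
Qed.

Lemma step_half_service1 p q : 0 <= q ->
  constrained_step upper_half_plane (p, q) service1 = (p - 1, q + 1).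
Proof.
move=> q0; rewrite /constrained_step asboolT //=.
by rewrite /upper_half_plane /=; lia.
Qed.

Lemma step_half_service2 p q : 0 <= q ->
  constrained_step upper_half_plane (p, q) service2 =
  if 0 < q then (p, q - 1) else (p, q).
Proof.
move=> q0; rewrite /constrained_step.
have -> : (p, q) + service2 = (p, q - 1) by congr pair; rewrite /= addr0.
by case: asboolP => /= H; case: ifPn => // H'; exfalso;
  move: H; rewrite /upper_half_plane /=; lia.
Qed.

Lemma mean_quadrantE f p q : 0 <= p -> 0 <= q ->
  mean quadrant f (p, q) = lambda * f (p + 1, q)
    + mu1 * f (if 0 < p then (p - 1, q + 1) else (p, q))
    + mu2 * f (if 0 < q then (p, q - 1) else (p, q)).
Proof.
move=> p0 q0; rewrite /mean_step.
by rewrite step_quadrant_arrival // step_quadrant_service1 // step_quadrant_service2.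
Qed.

Lemma mean_halfE f p q : 0 <= q ->
  mean upper_half_plane f (p, q) = lambda * f (p + 1, q)
    + mu1 * f (p - 1, q + 1)
    + mu2 * f (if 0 < q then (p, q - 1) else (p, q)).
Proof.
move=> q0; rewrite /mean_step.
by rewrite step_half_arrival // step_half_service1 // step_half_service2.
Qed.

Definition stable (S : set lattice) (B C : pred lattice) (D : set lattice) :=
  forall y, D y -> ~~ B y -> ~~ C y ->
  [/\ D (constrained_step S y arrival), D (constrained_step S y service1)
    & D (constrained_step S y service2)].

Lemma stable_quadrant B C : stable quadrant B C quadrant.
Proof.
move=> [p q] [/= p0 q0] _ _.
rewrite step_quadrant_arrival // step_quadrant_service1 // step_quadrant_service2 //.
by rewrite /quadrant /=; split; [split|case: ifP => /=|case: ifP => /=]; lia.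
Qed.

Lemma stable_quadrant_below n C :
  stable quadrant (level n) C [set y | quadrant y /\ y.1 + y.2 <= n%:Z].
Proof.
move=> [p q] [[/= p0 q0] pqn]; rewrite /level /= => pqN _.
rewrite step_quadrant_arrival // step_quadrant_service1 // step_quadrant_service2 //.
by rewrite /quadrant /=; split; [split|case: ifP => /=|case: ifP => /=]; lia.
Qed.

Lemma stable_half B C : stable upper_half_plane B C upper_half_plane.
Proof.
move=> [p q]; rewrite {1}/upper_half_plane /= => q0 _ _.
rewrite step_half_arrival // step_half_service1 // step_half_service2 //.
by rewrite /upper_half_plane /=; split; [|lia|case: ifP => /=; lia].
Qed.

(** The relation between the two walks from the moment the first queue is empty:
an unmatched first service moves the half-plane walk along its antidiagonal, up
and to the left. *)
Definition coupled (y ybar : lattice) :=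
  [/\ quadrant y, y.1 + y.2 = ybar.1 + ybar.2 & y.2 <= ybar.2].

(** The second queues of both walks are nonempty, so a second service happens in
both or in neither; this is where [0 < y.2] matters. *)
Lemma coupled_step y ybar : coupled y ybar -> 0 < y.2 ->
  [/\ coupled (constrained_step quadrant y arrival)
        (constrained_step upper_half_plane ybar arrival),
      coupled (constrained_step quadrant y service1)
        (constrained_step upper_half_plane ybar service1) &
      coupled (constrained_step quadrant y service2)
        (constrained_step upper_half_plane ybar service2)].
Proof.
case: y ybar => [p q] [pbar qbar] [[/= p0 q0] sum_eq q_le] q_gt0.
have qbar0 : 0 <= qbar by exact: le_trans q_le.
rewrite step_quadrant_arrival // step_quadrant_service1 // step_quadrant_service2 //.
rewrite step_half_arrival // step_half_service1 // step_half_service2 //.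
rewrite q_gt0 (lt_le_trans q_gt0 q_le) /coupled /quadrant /=.
split; [split; [split|..]|case: ifP => /= p_gt0; (split; [split|..])|
  split; [split|..]]; lia.
Qed.

Lemma step_half_eq_quadrant y : quadrant y -> 0 < y.1 ->
  [/\ constrained_step upper_half_plane y arrival =
        constrained_step quadrant y arrival,
      constrained_step upper_half_plane y service1 =
        constrained_step quadrant y service1 &
      constrained_step upper_half_plane y service2 =
        constrained_step quadrant y service2].
Proof.
case: y => [p q] [/= p0 q0] p_gt0.
rewrite step_quadrant_arrival // step_quadrant_service1 // step_quadrant_service2 //.
by rewrite step_half_arrival // step_half_service1 // step_half_service2 // p_gt0.
Qed.

Hypotheses (lambda_ge0 : 0 <= lambda) (mu1_ge0 : 0 <= mu1) (mu2_ge0 : 0 <= mu2).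

Lemma ler_mean S f g y :
  f (constrained_step S y arrival) <= g (constrained_step S y arrival) ->
  f (constrained_step S y service1) <= g (constrained_step S y service1) ->
  f (constrained_step S y service2) <= g (constrained_step S y service2) ->
  mean S f y <= mean S g y.
Proof. by move=> *; rewrite /mean_step !lerD // ler_wpM2l. Qed.

Lemma ler_norm_average_sub (m x y z x' y' z' r s t : R) : 0 <= m ->
  m * `|x - x'| <= r -> m * `|y - y'| <= s -> m * `|z - z'| <= t ->
  m * `|lambda * x + mu1 * y + mu2 * z - (lambda * x' + mu1 * y' + mu2 * z')|
    <= lambda * r + mu1 * s + mu2 * t.
Proof.
move=> m0 xr ys zt.
have -> : lambda * x + mu1 * y + mu2 * z - (lambda * x' + mu1 * y' + mu2 * z')
  = lambda * (x - x') + mu1 * (y - y') + mu2 * (z - z') by ring.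
apply: le_trans (ler_wpM2l m0 (ler_normD _ _)) _; rewrite mulrDr; apply: lerD.
  apply: le_trans (ler_wpM2l m0 (ler_normD _ _)) _; rewrite mulrDr; apply: lerD.
    by rewrite normrM (ger0_norm lambda_ge0) mulrCA ler_wpM2l.
  by rewrite normrM (ger0_norm mu1_ge0) mulrCA ler_wpM2l.
by rewrite normrM (ger0_norm mu2_ge0) mulrCA ler_wpM2l.
Qed.

(** A nonnegative superharmonic function that is at least [M] on the target
dominates [M] times the hitting probability, since the optional stopping
inequality holds at every finite time. *)
Lemma hit_prob_le S B C D (M : R) w : stable S B C D -> 
  (forall y, D y -> 0 <= w y) ->
  (forall y, D y -> B y -> M <= w y) ->
  (forall y, D y -> ~~ B y -> ~~ C y -> mean S w y <= w y) ->
  forall k y, D y -> M * hit_prob lambda mu1 mu2 S B C k y <= w y.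
Proof.
move=> stD w0 wB wmean; elim => [|k IH] y Dy.
  rewrite /=; case: ifPn => By; first by rewrite mulr1 wB.
  by rewrite if_same mulr0 w0.
have [By|By] := boolP (B y); first by rewrite /= By mulr1 wB.
have [Cy|Cy] := boolP (C y); first by rewrite /= (negbTE By) Cy mulr0 w0.
apply: le_trans (wmean _ Dy By Cy).
have [Da Db Dc] := stD _ Dy By Cy.
rewrite hit_probS //.
have -> : M * mean S (hit_prob lambda mu1 mu2 S B C k) y =
  mean S (fun y => M * hit_prob lambda mu1 mu2 S B C k y) y.
  by rewrite /mean_step; ring.
by apply: ler_mean; apply: IH.
Qed.

Lemma hit_prob_ge0 S B C k y : 0 <= hit_prob lambda mu1 mu2 S B C k y.
Proof.
elim: k y => [|k IH] y /=; do 2?case: ifP => // _.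
by rewrite /mean_step !addr_ge0 // mulr_ge0.
Qed.

(** Dually for a subharmonic function, up to the paths that have not stopped by
time [k].  A uniform gain [delta] with the bound [g <= M] makes [g] grow on
average by the factor [1 + delta / M] in each step, and these paths therefore
contribute only a geometrically small remainder: no separate proof that the walk
stops is needed. *)
Lemma hit_prob_ge S B C D (M delta : R) g : stable S B C D ->
  0 < M -> 0 < delta ->
  (forall y, D y -> g y <= M) ->
  (forall y, D y -> C y -> g y <= 0) ->
  (forall y, D y -> ~~ B y -> ~~ C y -> g y + delta <= mean S g y) ->
  lambda + mu1 + mu2 = 1 ->
  forall k y, D y ->
    g y <= M * (hit_prob lambda mu1 mu2 S B C k y + (1 + delta / M)^-1 ^+ k).
Proof.
move=> stD M0 d0 gM gC gmean rates_sum.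
set r := (1 + delta / M)^-1.
have dM : 0 < delta / M by rewrite divr_gt0.
have r0 : 0 < r by rewrite invr_gt0 addr_gt0.
have rk k : 0 <= r ^+ k by rewrite exprn_ge0 // ltW.
have gMr k y : D y -> C y ->
    g y <= M * (hit_prob lambda mu1 mu2 S B C k y + r ^+ k).
  move=> Dy Cy; apply: le_trans (gC _ Dy Cy) _.
  by rewrite mulr_ge0 ?addr_ge0 ?hit_prob_ge0 // ltW.
elim => [|k IH] y Dy.
  by rewrite expr0 (le_trans (gM _ Dy)) // ler_peMr ?(ltW M0) // lerDr hit_prob_ge0.
have [By|By] := boolP (B y).
  by rewrite /= By (le_trans (gM _ Dy)) // ler_peMr ?(ltW M0) // lerDl.
have [Cy|Cy] := boolP (C y); first exact: gMr.
rewrite hit_probS //.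
have [Da Db Dc] := stD _ Dy By Cy.
set h := hit_prob _ _ _ _ _ _ k.
have le1 : mean S g y <= M * (mean S h y + r ^+ k).
  have -> : M * (mean S h y + r ^+ k) = mean S (fun y => M * (h y + r ^+ k)) y.
    rewrite -[r ^+ k in LHS]mul1r -rates_sum /mean_step; ring.
  by apply: ler_mean; apply: IH.
have mh0 : 0 <= mean S h y.
  by rewrite /mean_step !addr_ge0 // mulr_ge0 // hit_prob_ge0.
have le2 : (1 + delta / M) * g y <= M * (mean S h y + r ^+ k).
  apply: le_trans le1; apply: le_trans (gmean _ Dy By Cy).
  rewrite mulrDl mul1r lerD2l -mulrA ler_piMr ?(ltW d0) //.
  by rewrite mulrC ler_pdivrMr // mul1r gM.
have -> : g y = r * ((1 + delta / M) * g y).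
  by rewrite mulrA mulVf ?mul1r // gt_eqF // addr_gt0.
apply: le_trans (ler_wpM2l (ltW r0) le2) _.
rewrite mulrCA; apply: ler_wpM2l; first exact: ltW.
rewrite mulrDr exprS lerD2r ler_piMl // /r invf_le1 ?lerDl ?(ltW dM) //.
by rewrite addr_gt0.
Qed.

End Averages.

(** * Superharmonic functions and the upper bound *)

Section Barriers.
Variables (R : realType) (lambda mu1 mu2 : R).
Hypotheses (lambda_gt0 : 0 < lambda) (mu1_gt0 : 0 < mu1) (mu2_gt0 : 0 < mu2).
Hypotheses (rates_sum : lambda + mu1 + mu2 = 1).
Hypotheses (lambda_lt_mu1 : lambda < mu1) (lambda_lt_mu2 : lambda < mu2).
Variable b : R.
Hypotheses (b_gt1 : 1 < b).

Local Notation mean := (mean_step lambda mu1 mu2).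
Local Notation hit_prob := (hit_prob lambda mu1 mu2).

Let b0 : 0 < b. Proof. exact: lt_trans b_gt1. Qed.
Let bN0 : b != 0. Proof. by rewrite gt_eqF. Qed.
Let bX_gt0 (p : int) : 0 < b ^ p. Proof. by rewrite exprz_gt0. Qed.
Let bX_ge0 (p : int) : 0 <= b ^ p. Proof. exact: ltW. Qed.

(** For a walk on the integers stepping up at rate [lambda] and down at rate [mu],
the mean change of [b ^ p] in one step is [- drift mu * b ^ p]; its sign changes
at [b = mu / lambda]. *)
Definition drift (mu : R) : R := mu * (1 - b^-1) - lambda * (b - 1).

Lemma drift_gt0 mu : lambda * b < mu -> 0 < drift mu.
Proof.
move=> H; have -> : drift mu = (b - 1) * b^-1 * (mu - lambda * b).
  rewrite /drift; by field.
by rewrite !mulr_gt0 ?subr_gt0 ?invr_gt0.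
Qed.

Lemma drift_lt0 mu : mu < lambda * b -> drift mu < 0.
Proof.
move=> H; have -> : drift mu = - ((b - 1) * b^-1 * (lambda * b - mu)).
  rewrite /drift; by field.
by rewrite oppr_lt0 !mulr_gt0 ?subr_gt0 ?invr_gt0.
Qed.

Lemma exprz_succ (c : R) (p : int) : c != 0 -> c ^ (p + 1) = c ^ p * c.
Proof. by move=> c0; rewrite expfzDr. Qed.

Lemma exprz_pred (c : R) (p : int) : c != 0 -> c ^ (p - 1) = c ^ p * c^-1.
Proof. by move=> c0; rewrite expfzDr // exprN1. Qed.

Lemma exprz_nonneg_ge1 (c : R) (p : int) : 1 <= c -> 0 <= p -> 1 <= c ^ p.
Proof. by move=> c1; case: p => // m _; rewrite exprn_ege1. Qed.

Section Upper.
Hypotheses (b_mu1 : lambda * b < mu1) (b_mu2 : lambda * b < mu2).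

Let d1 := drift mu1.
Let d2 := drift mu2.
Let e := lambda * (b - 1).
Let d1_gt0 : 0 < d1. Proof. exact: drift_gt0. Qed.
Let d2_gt0 : 0 < d2. Proof. exact: drift_gt0. Qed.
Let d1_ge0 : 0 <= d1. Proof. exact: ltW. Qed.
Let d2_ge0 : 0 <= d2. Proof. exact: ltW. Qed.
Let e_gt0 : 0 < e. Proof. by rewrite mulr_gt0 ?subr_gt0. Qed.
(* When a queue is empty its service no longer pulls the exponentials down, and
   they gain [e] times their value on average.  The constant [a] compensates the
   empty second queue in [barrier_half], [K] the empty first queue in
   [barrier_axis]. *)
Variables a K : R.
Hypotheses (a_ge0 : 0 <= a) (ad1 : a * d1 = e).
Hypotheses (K_ge0 : 0 <= K) (K_drift : K * (mu2 - lambda) = e).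

(** The first term is superharmonic except on the horizontal axis, where its gain
is cancelled exactly by the loss of the second term. *)
Definition barrier_half (y : lattice) : R := b ^ (y.1 + y.2) + a * b ^ y.1.

Lemma barrier_half_ge0 y : 0 <= barrier_half y.
Proof. by rewrite addr_ge0 // mulr_ge0. Qed.

Lemma mean_barrier_half y : 0 <= y.2 ->
  mean upper_half_plane barrier_half y <= barrier_half y.
Proof.
case: y => p q /= q0; rewrite mean_halfE //.
rewrite /barrier_half; case: ltP => /= Hq.
  rewrite !(exprz_succ, exprz_pred, expfzDr) //.
  have X0 := bX_ge0 p.
  have Z0 := bX_ge0 q.
  set X := b ^ p in X0 *; set Z := b ^ q in Z0 *.
  rewrite -subr_ge0.
  have -> : X * Z + a * X -
    (lambda * (X * b * Z + a * (X * b)) +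
     mu1 * (X * b^-1 * (Z * b) + a * (X * b^-1)) +
     mu2 * (X * (Z * b^-1) + a * X)) = X * Z * d2 + a * X * d1.
    rewrite /d1 /d2 /drift (_ : mu1 = 1 - lambda - mu2); last by rewrite -rates_sum; ring.
    by field.
  by rewrite addr_ge0 ?mulr_ge0.
have -> : q = 0 by apply/eqP; rewrite eq_le q0 andbT.
rewrite !(exprz_succ, exprz_pred, expfzDr, addr0, add0r) //.
have X0 := bX_ge0 p.
set X := b ^ p in X0 *.
rewrite -subr_ge0 [X in 0 <= X](_ : _ = X * (a * d1 - e)).
  by rewrite ad1 subrr mulr0.
rewrite /e /d1 /drift (_ : mu2 = 1 - lambda - mu1); last by rewrite -rates_sum; ring.
by field.
Qed.

Lemma hit_prob_half_le n k y : 0 <= y.2 ->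
  b ^+ n * hit_prob upper_half_plane (level n) pred0 k y <= barrier_half y.
Proof.
move=> y0.
apply: (hit_prob_le (ltW lambda_gt0) (ltW mu1_gt0) (ltW mu2_gt0) (D := upper_half_plane)) => //.
- exact: stable_half.
- by move=> z _; exact: barrier_half_ge0.
- move=> [p q] _ /eqP /= Hn.
  by rewrite /barrier_half /= Hn lerDl mulr_ge0.
- by move=> z z0 _ _; exact: mean_barrier_half.
Qed.

(* Near the origin the gain of [a * b ^ y.1] on the vertical axis exceeds the loss
   of [b ^ (y.1 + y.2)]; [B] is the weight of the bounded correction made there. *)
Variable B : R.
Hypothesis B_ge0 : 0 <= B.
Hypothesis B_big :
  forall m : nat, a * e <= d2 * b ^+ m + B * lambda * 3^-1 ^+ m.

(** The exponent [y.1 + y.1 + y.2] drops by one at each service, of either queue.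
With the small base [1 / 3] these drops outweigh the arrivals, so the last term
has negative drift away from the origin while staying between [0] and [B].  At
the origin only arrivals occur and every term increases, which is why the origin
has to be a taboo state. *)
Definition barrier_quadrant (y : lattice) : R :=
  barrier_half y + B * (1 - 3^-1 ^ (y.1 + y.1 + y.2)).

Lemma barrier_quadrant_ge y : quadrant y -> barrier_half y <= barrier_quadrant y.
Proof.
case: y => p q [/= p0 q0]; rewrite /barrier_quadrant lerDl mulr_ge0 // subr_ge0.
rewrite /= exprz_inv -invr_expz invf_le1 ?exprz_gt0 ?exprz_nonneg_ge1 ?ler1n //.
by rewrite !addr_ge0.
Qed.

Lemma barrier_quadrant_le y :
  barrier_quadrant y <= barrier_half y + B.
Proof.
by rewrite /barrier_quadrant lerD2l ler_piMr // gerDl oppr_le0 exprz_ge0.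
Qed.

Let service12_dominates : 0 <= 2 * mu1 + 2 * mu2 - 8 / 9 * lambda.
Proof. by move: lambda_gt0 lambda_lt_mu1 lambda_lt_mu2 => h1 h2 h3; lra. Qed.

Let service1_dominates : 0 <= 2 * mu1 - 8 / 9 * lambda.
Proof. by move: lambda_gt0 lambda_lt_mu1 lambda_lt_mu2 => h1 h2 h3; lra. Qed.

Let service2_dominates : 0 <= 2 * mu2 - 17 / 9 * lambda.
Proof. by move: lambda_gt0 lambda_lt_mu1 lambda_lt_mu2 => h1 h2 h3; lra. Qed.

Lemma mean_barrier_quadrant y : quadrant y -> y != 0 ->
  mean quadrant barrier_quadrant y <= barrier_quadrant y.
Proof.
case: y => p q [/= p0 q0] y0; rewrite mean_quadrantE //.
have t0 : (3^-1 : R) != 0 by [].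
rewrite /barrier_quadrant /barrier_half.
have X0 := bX_ge0 p.
have Z0 := bX_ge0 q.
have T0 : 0 <= (3^-1 : R) ^ p by rewrite exprz_ge0.
have U0 : 0 <= (3^-1 : R) ^ q by rewrite exprz_ge0.
have lq : a * e <= d2 * b ^ q + B * lambda * 3^-1 ^ q.
  by case: (q) q0 => // m _; exact: B_big.
rewrite -subr_ge0.
case: (ltP 0 p) => /= Hp; case: (ltP 0 q) => /= Hq.
- rewrite !(exprz_succ, exprz_pred, expfzDr) // invrK.
  set X := b ^ p in X0 *; set Z := b ^ q in Z0 *.
  set T := 3^-1 ^ p in T0 *; set U := 3^-1 ^ q in U0 *.
  rewrite [X in 0 <= X](_ : _ = X * Z * d2 + a * X * d1 +
    B * (T * T * U) * (2 * mu1 + 2 * mu2 - 8 / 9 * lambda)); last first.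
    rewrite /d1 /d2 /drift (_ : mu1 = 1 - lambda - mu2); last by rewrite -rates_sum; ring.
    by field.
  by rewrite addr_ge0 ?addr_ge0 ?mulr_ge0.
- have -> : q = 0 by apply/eqP; rewrite eq_le q0 andbT.
  rewrite !(exprz_succ, exprz_pred, expfzDr, addr0, add0r, expr1z, expr0z) //.
  set X := b ^ p in X0 *; set T := 3^-1 ^ p in T0 *.
  rewrite invrK [X in 0 <= X](_ : _ = X * (a * d1 - e) +
    B * (T * T) * (2 * mu1 - 8 / 9 * lambda)); last first.
    rewrite /e /d1 /drift (_ : mu2 = 1 - lambda - mu1); last by rewrite -rates_sum; ring.
    by field.
  by rewrite ad1 subrr mulr0 add0r !mulr_ge0.
- have -> : p = 0 by apply/eqP; rewrite eq_le p0 andbT.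
  rewrite !(exprz_succ, exprz_pred, expfzDr, addr0, add0r, expr1z, expr0z) //.
  set Z := b ^ q in Z0 lq *; set U := 3^-1 ^ q in U0 lq *.
  rewrite invrK [X in 0 <= X](_ : _ = (d2 * Z + B * lambda * U - a * e) +
    B * U * (2 * mu2 - 17 / 9 * lambda)); last first.
    rewrite /e /d2 /drift (_ : mu1 = 1 - lambda - mu2); last by rewrite -rates_sum; ring.
    by field.
  by rewrite addr_ge0 ?subr_ge0 // !mulr_ge0.
- by move: y0; rewrite (le_anti (introT andP (conj Hp p0)))
    (le_anti (introT andP (conj Hq q0))) eqxx.
Qed.

Lemma hit_prob_quadrant_le n k y : quadrant y ->
  b ^+ n * hit_prob quadrant (level n) (pred1 0) k y <= barrier_quadrant y.
Proof.
move=> y0.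
apply: (hit_prob_le (ltW lambda_gt0) (ltW mu1_gt0) (ltW mu2_gt0) (D := quadrant)) => //.
- exact: stable_quadrant.
- by move=> z Qz; apply: le_trans (barrier_quadrant_ge Qz); exact: barrier_half_ge0.
- move=> [p q] Qy /eqP /= Hn; apply: le_trans (barrier_quadrant_ge Qy).
  by rewrite /barrier_half /= Hn lerDl mulr_ge0.
- by move=> z z0 _ zN0; exact: mean_barrier_quadrant.
Qed.

(** This bounds the difference of the two hitting probabilities as long as the
second queue is nonempty.  While the first queue is empty, [b ^ y.1] gains a
constant in each step, paid for by the linear term, since the sum of the
coordinates decreases on average.  On the vertical axis the value is only
affine in the sum, not exponential. *)
Definition barrier_axis (y : lattice) : R :=
  (1 + a + B) * (b ^ y.1 + K * (y.1 + y.2)%:~R).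

Lemma mean_barrier_axis y : quadrant y -> 0 < y.2 ->
  mean quadrant barrier_axis y <= barrier_axis y.
Proof.
case: y => p q [/= p0 _] q0; rewrite mean_quadrantE ?(ltW q0) // q0.
rewrite /barrier_axis -subr_ge0.
have X0 := bX_ge0 p.
case: (ltP 0 p) => /= Hp.
  rewrite !(exprz_succ, exprz_pred) // !rmorphD !rmorphN !rmorph1 /=.
  rewrite [X in 0 <= X](_ : _ =
    (1 + a + B) * (b ^ p * d1 + K * (mu2 - lambda))); last first.
    rewrite /d1 /drift (_ : mu2 = 1 - lambda - mu1); last by rewrite -rates_sum; ring.
    by field.
  rewrite K_drift; apply: mulr_ge0; first by rewrite !addr_ge0.
  by apply: addr_ge0; [exact: mulr_ge0|exact: ltW].
have -> : p = 0 by apply/eqP; rewrite eq_le p0 andbT.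
rewrite !(exprz_succ, add0r, expr0z) // !rmorphD !rmorphN !rmorph1 /=.
rewrite [X in 0 <= X](_ : _ = (1 + a + B) * (K * (mu2 - lambda) - e)).
  by rewrite K_drift subrr mulr0.
rewrite /e (_ : mu1 = 1 - lambda - mu2); last by rewrite -rates_sum; ring.
ring.
Qed.

Lemma barrier_axis_ge p q : 0 <= p -> 0 <= q ->
  (1 + a + B) * b ^ p <= barrier_axis (p, q).
Proof.
move=> p0 q0; rewrite /barrier_axis /= ler_wpM2l ?addr_ge0 // lerDl mulr_ge0 //.
by rewrite ler0z addr_ge0.
Qed.

Local Notation v n := (hit_prob quadrant (level n) (pred1 0)).
Local Notation vbar n := (hit_prob upper_half_plane (level n) pred0).

Let v_ge0 n k y : 0 <= v n k y.
Proof. by apply: hit_prob_ge0; exact: ltW. Qed.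

Let vbar_ge0 n k y : 0 <= vbar n k y.
Proof. by apply: hit_prob_ge0; exact: ltW. Qed.

(** Coupled walks hit together until the second queue of the tandem walk is empty.
At that moment the common sum is the first coordinate [y.1] of the tandem walk,
and both hitting probabilities are of order [b ^ y.1 / b ^ n]. *)
Lemma hit_prob_diff_le n k y ybar : coupled y ybar ->
  b ^+ n * `|v n k y - vbar n k ybar| <= barrier_axis y.
Proof.
have C0 : 0 <= 1 + a + B by rewrite !addr_ge0.
have n0 : 0 <= b ^+ n by exact: (bX_ge0 n).
elim: k y ybar => [|k IH] y ybar cy.
all: have [[y1_ge0 y2_ge0] sum_eq y2_le] := cy.
all: have A0 : 0 <= barrier_axis y
  by apply: le_trans (barrier_axis_ge y1_ge0 y2_ge0); rewrite mulr_ge0.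
all: have lvl : level n ybar = level n y by rewrite /level sum_eq.
all: have [Bn|NBn] := boolP (level n y);
  first by rewrite /= lvl Bn subrr normr0 mulr0.
  by rewrite /= lvl (negbTE NBn) if_same subrr normr0 mulr0.
have [y2_gt0|y2_le0] := ltP 0 y.2; last first.
  have y2E : y.2 = 0 by apply/eqP; rewrite eq_le y2_ge0 andbT.
  rewrite y2E addr0 in sum_eq y2_le.
  have le_y1 : ybar.1 <= y.1 by rewrite sum_eq lerDl.
  have Xp1 : 1 <= b ^ y.1 by rewrite exprz_nonneg_ge1 // ltW.
  apply: le_trans (barrier_axis_ge y1_ge0 y2_ge0).
  have bv : b ^+ n * v n k.+1 y <= (1 + a + B) * b ^ y.1.
    apply: le_trans (hit_prob_quadrant_le n k.+1 _) _; first by split.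
    apply: le_trans (barrier_quadrant_le _) _.
    rewrite /barrier_half /= y2E addr0 !mulrDl mul1r lerD2l.
    by rewrite ler_peMr.
  have bvbar : b ^+ n * vbar n k.+1 ybar <= (1 + a + B) * b ^ y.1.
    apply: le_trans (hit_prob_half_le n k.+1 _) _; first exact: y2_le.
    rewrite /barrier_half /= -sum_eq !mulrDl mul1r -addrA lerD2l.
    apply: ler_wpDr; first exact: mulr_ge0.
    by rewrite ler_wpM2l // ler_weXz2l // ltW.
  rewrite -[X in X * _]ger0_norm // -normrM mulrBr ler_norml.
  rewrite lerBrDr lerBlDr; apply/andP; split.
    apply: (@le_trans _ _ 0); last by rewrite mulr_ge0.
    by rewrite addrC subr_le0.
  by apply: le_trans bv _; rewrite lerDl mulr_ge0.
have yN0 : y != 0.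
  by apply/eqP => yE; rewrite yE ltxx in y2_gt0.
rewrite !hit_probS ?lvl //.
apply: le_trans (mean_barrier_axis _ y2_gt0); last by split.
have [cya cyb cyc] := coupled_step cy y2_gt0.
by apply: ler_norm_average_sub; rewrite ?(ltW lambda_gt0) ?(ltW mu1_gt0)
  ?(ltW mu2_gt0) // IH.
Qed.

(** Until the first queue is empty the two walks are the same, so only the values
of [barrier_axis] on the vertical axis matter. *)
Lemma hit_prob_diff_le_linear n k y : quadrant y -> y.1 + y.2 <= n%:Z ->
  b ^+ n * `|v n k y - vbar n k y| <= (1 + a + B) * (1 + K * n%:R).
Proof.
have C0 : 0 <= 1 + a + B by rewrite !addr_ge0.
have n0 : 0 <= b ^+ n by exact: (bX_ge0 n).
have E0 : 0 <= (1 + a + B) * (1 + K * n%:R) by rewrite !mulr_ge0 // addr_ge0 // mulr_ge0.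
elim: k y => [|k IH] y Qy yn.
  by rewrite /=; case: ifP => _; rewrite ?if_same subrr normr0 mulr0.
have [y1_ge0 y2_ge0] := Qy.
have [y1_gt0|y1_le0] := ltP 0 y.1; last first.
  have y1E : y.1 = 0 by apply/eqP; rewrite eq_le y1_ge0 andbT.
  apply: le_trans (hit_prob_diff_le n k.+1 (And3 Qy erefl (lexx y.2))) _.
  rewrite /barrier_axis y1E expr0z ler_wpM2l // lerD2l ler_wpM2l //.
  by rewrite -[n%:R]/(n%:Z%:~R) ler_int -y1E.
have [Bn|Bn] := boolP (level n y); first by rewrite /= Bn subrr normr0 mulr0.
have yN0 : y != 0.
  by apply/eqP => yE; rewrite yE ltxx in y1_gt0.
rewrite !hit_probS //; move: E0 IH; set E := (1 + a + B) * _ => E0 IH.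
rewrite -[leRHS]mul1r -rates_sum !mulrDl /mean_step.
have [-> -> ->] := step_half_eq_quadrant Qy y1_gt0.
have [[Qa ya] [Qb yb] [Qc yc]] :=
  stable_quadrant_below (C := pred1 0) (conj Qy yn) Bn yN0.
by apply: ler_norm_average_sub => //; try exact: ltW; exact: IH.
Qed.

End Upper.

(** * Subharmonic functions and the lower bound *)

Local Notation v n := (hit_prob quadrant (level n) (pred1 0)).

Section Lower.
Variables (n : nat) (l : lattice -> int) (delta : R).
Hypotheses (delta_gt0 : 0 < delta) (l0 : l 0 = 0).
Hypothesis l_le : forall y, quadrant y -> l y <= y.1 + y.2.
Hypothesis l_mean : forall y, quadrant y -> y != 0 ->
  b ^ l y + delta <= mean quadrant (fun z => b ^ l z) y.

Lemma hit_prob_lower k y : quadrant y -> y.1 + y.2 <= n%:Z ->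
  b ^ l y - 1 <= b ^+ n * (v n k y + (1 + delta / b ^+ n)^-1 ^+ k).
Proof.
move=> Qy yn; apply: (hit_prob_ge (ltW lambda_gt0) (ltW mu1_gt0) (ltW mu2_gt0)
  (stable_quadrant_below (n := n) (C := pred1 0))
  (g := fun z => b ^ l z - 1) _ delta_gt0 _ _ _ rates_sum) => //.
- exact: (bX_gt0 n).
- move=> z [Qz zn]; apply: (@le_trans _ _ (b ^ l z)); first by rewrite gerBl.
  apply: (@le_trans _ _ (b ^ n%:Z)); last by [].
  by rewrite ler_weXz2l ?(ltW b_gt1) // (le_trans (l_le Qz)).
- by move=> z _ /eqP ->; rewrite l0 expr0z subrr.
- move=> z [Qz zn] _ zN0.
  have -> : mean quadrant (fun z => b ^ l z - 1) z =
      mean quadrant (fun z => b ^ l z) z - 1.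
    by rewrite -[1 in RHS]rates_sum /mean_step; ring.
  by rewrite addrAC lerD2r l_mean.
Qed.

Lemma hit_prob_lim_lower (p : R) y : quadrant y -> y.1 + y.2 <= n%:Z ->
  v n k y @[k --> \oo] --> p -> b ^ l y - 1 <= b ^+ n * p.
Proof.
move=> Qy yn vp; have bn0 : 0 < b ^+ n by exact: (bX_gt0 n).
set r := (1 + delta / b ^+ n)^-1.
have r0 : 0 < 1 + delta / b ^+ n by rewrite addr_gt0 // divr_gt0.
have rc : r ^+ k @[k --> \oo] --> 0.
  apply: cvg_expr; rewrite gtr0_norm ?invr_gt0 //.
  by rewrite invf_lt1 // ltrDl divr_gt0.
have c2 : b ^+ n * (v n k y + r ^+ k) @[k --> \oo] --> b ^+ n * p.
  by rewrite -[p]addr0; apply: cvgMl_tmp; apply: cvgD.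
apply: (ler_cvg_to (cvg_cst (b ^ l y - 1)) c2).
by apply: nearW => k; exact: hit_prob_lower.
Qed.

End Lower.

(** The first queue is a birth and death chain, and must be empty at the origin;
reaching [n] in the first coordinate requires reaching level [n]. *)
Lemma hit_prob_lim_lower1 n p y : mu1 < lambda * b ->
  quadrant y -> y.1 + y.2 <= n%:Z ->
  v n k y @[k --> \oo] --> p -> b ^ y.1 - 1 <= b ^+ n * p.
Proof.
move=> b_mu1; have d1 := drift_lt0 b_mu1.
apply: (@hit_prob_lim_lower n (fun y => y.1) (- drift mu1)) => //.
- by rewrite oppr_gt0.
- by move=> z [_ z2]; rewrite lerDl.
move=> [p' q] [/= p0 q0] _; rewrite mean_quadrantE // -subr_ge0.
case: (ltP 0 p') => Hp /=.
  rewrite !(exprz_succ, exprz_pred) //.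
  rewrite [X in 0 <= X](_ : _ = (b ^ p' - 1) * (- drift mu1)); last first.
    rewrite (fun_if fst) if_same.
    rewrite /drift (_ : mu2 = 1 - lambda - mu1); last by rewrite -rates_sum; ring.
    by field.
  by rewrite mulr_ge0 ?oppr_ge0 ?(ltW d1) // subr_ge0 exprz_nonneg_ge1 // ltW.
have -> : p' = 0 by apply/eqP; rewrite eq_le Hp p0.
rewrite (fun_if fst) if_same exprz_succ // expr0z.
rewrite [X in 0 <= X](_ : _ = mu1 * (1 - b^-1)); last first.
  rewrite /drift (_ : mu2 = 1 - lambda - mu1); last by rewrite -rates_sum; ring.
  by ring.
by rewrite mulr_ge0 ?(ltW mu1_gt0) // subr_ge0 invf_le1 // ltW.
Qed.

(** The sum of the coordinates goes up at rate [lambda] and down at rate at most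
[mu2]. *)
Lemma hit_prob_lim_lower2 n p y : mu2 < lambda * b ->
  quadrant y -> y.1 + y.2 <= n%:Z ->
  v n k y @[k --> \oo] --> p -> b ^ (y.1 + y.2) - 1 <= b ^+ n * p.
Proof.
move=> b_mu2; have d2 := drift_lt0 b_mu2.
apply: (@hit_prob_lim_lower n (fun y => y.1 + y.2) (- drift mu2)) => //.
- by rewrite oppr_gt0.
move=> [p' q] [/= p0 q0] _; rewrite mean_quadrantE // -subr_ge0.
have -> : (if 0 < p' then (p' - 1, q + 1) else (p', q)).1
    + (if 0 < p' then (p' - 1, q + 1) else (p', q)).2 = p' + q.
  by case: ifP => //= _; rewrite addrACA addNr addr0.
rewrite /= [p' + 1 + q]addrAC exprz_succ //.
have X1 : 1 <= b ^ (p' + q) by rewrite exprz_nonneg_ge1 ?addr_ge0 // ltW.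
case: (ltP 0 q) => Hq /=.
  rewrite addrA exprz_pred //.
  rewrite [X in 0 <= X](_ : _ = (b ^ (p' + q) - 1) * (- drift mu2)); last first.
    rewrite /drift (_ : mu1 = 1 - lambda - mu2); last by rewrite -rates_sum; ring.
    by field.
  by rewrite mulr_ge0 ?oppr_ge0 ?(ltW d2) // subr_ge0.
rewrite [X in 0 <= X](_ : _ = (b ^ (p' + q) - 1) * (lambda * (b - 1)) +
   mu2 * (1 - b^-1)); last first.
  rewrite /drift (_ : mu1 = 1 - lambda - mu2); last by rewrite -rates_sum; ring.
  by ring.
rewrite addr_ge0 // mulr_ge0 ?(ltW mu2_gt0) ?subr_ge0 //.
  by rewrite mulr_ge0 ?(ltW lambda_gt0) // subr_ge0 ltW.
by rewrite invf_le1 // ltW.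
Qed.

End Barriers.

(** * The exit probabilities *)

Section ExitLink.
Context (d : measure_display) (Omega : measurableType d) (R : realType).
Variables (P : probability Omega R) (xi : nat -> Omega -> lattice).
Variables (lambda mu1 mu2 : R).
Hypothesis rates_sum : lambda + mu1 + mu2 = 1.
Hypothesis xi_iid : iid_tandem_increments P lambda mu1 mu2 xi.

(** For [n = 0] the origin would belong to both the target and the taboo set. *)
Lemma exit_prob_cvg n y : (0 < n)%N ->
  hit_prob lambda mu1 mu2 quadrant (level n) (pred1 0) k y @[k --> \oo]
    --> exit_prob P xi y n.
Proof.
move=> n0; rewrite /exit_prob.
rewrite [X in P X](_ : _ =
    \bigcup_k hits_within xi quadrant (level n) (pred1 0) 0 k y).
  exact: hit_prob_cvg rates_sum xi_iid _ _ _ _.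
have disj z : sum_level n z -> ~ [set 0] z.
  rewrite /sum_level /= => zn z0; move: zn; rewrite z0 /= => /eqP.
  by rewrite eq_sym addr0 => /eqP[] nE; rewrite nE in n0.
apply/seteqP; split => w.
  move=> /(hitting_time_lt _ _ _ disj)[k [kn k0]].
  exists k => //; exists k; split => //; first exact/eqP.
  by move=> l lk; apply/eqP/k0.
move=> [k _ [i [_ /eqP iB iC]]]; apply/(hitting_time_lt _ _ _ disj).
by exists i; split => // l li; apply/eqP/iC.
Qed.

Lemma exit_prob_bar_cvg n y :
  hit_prob lambda mu1 mu2 upper_half_plane (level n) pred0 k y @[k --> \oo]
    --> exit_prob_bar P xi y n.
Proof.
rewrite /exit_prob_bar.
rewrite [X in P X](_ : _ =
    \bigcup_k hits_within xi upper_half_plane (level n) pred0 0 k y).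
  exact: hit_prob_cvg rates_sum xi_iid _ _ _ _.
apply/seteqP; split => w.
  move=> /hitting_time_lty[k kn].
  by exists k => //; exists k; split => //; exact/eqP.
by move=> [k _ [i [_ /eqP iB _]]]; apply/hitting_time_lty; exists i.
Qed.

End ExitLink.

(** * Growth estimates *)

Section Asymptotics.
Variable R : realType.

(** With [h := 1 + kappa / 2 * n], the exponential is at least [h * h], and one
factor [h] absorbs each of the two factors on the left. *)
Lemma affine_le_expR (A K kappa : R) : 0 <= A -> 0 <= K -> 0 < kappa ->
  \forall n \near \oo, A * (1 + K * n%:R) <= expR (kappa * n%:R).
Proof.
move=> A0 K0 k0; set M := 1 + 2 * K / kappa.
have M1 : 1 <= M by rewrite lerDl !mulr_ge0 // invr_ge0 ltW.
near=> n.
set h := 1 + kappa / 2 * n%:R.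
have h0 : 0 <= h by rewrite addr_ge0 // !mulr_ge0 // ltW.
have hM : 1 + K * n%:R <= M * h.
  have -> : M * h = 1 + K * n%:R + (2 * K / kappa + kappa / 2 * n%:R).
    by rewrite /M /h; field; rewrite gt_eqF.
  by rewrite lerDl addr_ge0 // !mulr_ge0 // ?invr_ge0 ltW.
have AMh : A * M <= h.
  rewrite -lerBlDl [leRHS]mulrC -ler_pdivrMr ?divr_gt0 //.
  by near: n; exact: nbhs_infty_ger.
have hexp : h * h <= expR (kappa * n%:R).
  have -> : kappa * n%:R = kappa / 2 * n%:R + kappa / 2 * n%:R by field.
  by rewrite expRD ler_pM // expR_ge1Dx.
apply: le_trans hexp; apply: le_trans (ler_wpM2l A0 hM) _.
by rewrite mulrA ler_wpM2r.
Unshelve. all: by end_near. Qed.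

(** Existence of the weight [B] in [barrier_quadrant]: the first term suffices for
large [m], and [B] takes care of the finitely many others. *)
Lemma geometric_dominates (b r c d : R) : 1 < b -> 0 <= c -> 0 < d -> 0 < r ->
  exists2 B : R, 0 <= B &
    forall m : nat, c <= d * b ^+ m + B * r * 3^-1 ^+ m.
Proof.
move=> b1 c0 d0 r0; have b0 : 0 < b by exact: lt_trans b1.
have lnb : 0 < ln b by rewrite ln_gt0.
have [m0 _ m0P] := affine_le_expR (divr_ge0 c0 (ltW d0)) ler01 lnb.
have bm0 : c <= d * b ^+ m0.
  rewrite mulrC -ler_pdivrMr //.
  have := m0P m0 (leqnn _); rewrite /= mulrC [ln b * _]mulrC expRM_natl lnK ?posrE //.
  by apply: le_trans; rewrite ler_peMl ?divr_ge0 ?(ltW d0) // mul1r lerDl.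
have t0 k : 0 <= (3^-1 : R) ^+ k by rewrite exprn_ge0.
exists (c / r * 3 ^+ m0); first by rewrite !mulr_ge0 ?invr_ge0 ?exprn_ge0 // ltW.
move=> m; have -> : c / r * 3 ^+ m0 * r * 3^-1 ^+ m = c * (3 ^+ m0 * 3^-1 ^+ m).
  by field; rewrite gt_eqF.
have [mm0|m0m] := leqP m m0.
  apply: ler_wpDl; first by rewrite mulr_ge0 ?(ltW d0) // exprn_ge0 // ltW.
  rewrite ler_peMr // exprVn ler_pdivlMr ?exprn_gt0 // mul1r.
  by rewrite ler_eXn2l // ltr1n.
apply: ler_wpDr; first by rewrite !mulr_ge0 // exprn_ge0.
apply: le_trans bm0 _; rewrite ler_wpM2l ?(ltW d0) // ler_eXn2l //.
exact: ltnW.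
Qed.

Lemma expRMz (x : R) (m : int) : expR x ^ m = expR (m%:~R * x).
Proof.
case: m => m; first by rewrite expRM_natl.
by rewrite NegzE -exprz_inv -expRN -exprnP mulNr -mulrN expRM_natl.
Qed.

End Asymptotics.

(** * Exponential decay of the relative error *)

Section Bounds.
Context (d : measure_display) (Omega : measurableType d) (R : realType).
Variables (P : probability Omega R) (xi : nat -> Omega -> lattice).
Variables (lambda mu1 mu2 : R).
Hypotheses (lambda_gt0 : 0 < lambda) (mu1_gt0 : 0 < mu1) (mu2_gt0 : 0 < mu2).
Hypothesis rates_sum : lambda + mu1 + mu2 = 1.
Hypothesis xi_iid : iid_tandem_increments P lambda mu1 mu2 xi.
Hypotheses (lambda_lt_mu1 : lambda < mu1) (lambda_lt_mu2 : lambda < mu2).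

Lemma exit_prob_diff_le (b : R) : 1 < b -> lambda * b < mu1 -> lambda * b < mu2 ->
  exists C K : R, [/\ 0 <= C, 0 <= K & forall n y, (0 < n)%N -> quadrant y ->
    y.1 + y.2 <= n%:Z ->
    b ^+ n * `|exit_prob P xi y n - exit_prob_bar P xi y n|
      <= C * (1 + K * n%:R)].
Proof.
move=> b1 b_mu1 b_mu2.
have b0 : 0 < b by exact: lt_trans b1.
have d1 := drift_gt0 b1 b_mu1.
have d2 := drift_gt0 b1 b_mu2.
have e0 : 0 < lambda * (b - 1) by rewrite mulr_gt0 // subr_gt0.
set a := lambda * (b - 1) / drift lambda b mu1.
set K := lambda * (b - 1) / (mu2 - lambda).
have a0 : 0 < a by rewrite divr_gt0.
have K0 : 0 < K by rewrite divr_gt0 // subr_gt0.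
have ad1 : a * drift lambda b mu1 = lambda * (b - 1) by rewrite divfK ?gt_eqF.
have Kd : K * (mu2 - lambda) = lambda * (b - 1) by rewrite divfK ?gt_eqF ?subr_gt0.
have [B B0 HB] := geometric_dominates b1 (mulr_ge0 (ltW a0) (ltW e0)) d2 lambda_gt0.
exists (1 + a + B), K; split; [by rewrite !addr_ge0 // ltW|exact: ltW|].
move=> n y n0 Qy yn.
set v := fun k => hit_prob lambda mu1 mu2 quadrant (level n) (pred1 0) k y.
set vbar := fun k => hit_prob lambda mu1 mu2 upper_half_plane (level n) pred0 k y.
have diff_cvg : b ^+ n * `|v k - vbar k| @[k --> \oo] -->
    b ^+ n * `|exit_prob P xi y n - exit_prob_bar P xi y n|.
  apply: cvgMl_tmp; apply: cvg_norm; apply: cvgB; first exact: exit_prob_cvg.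
  exact: exit_prob_bar_cvg.
apply: (ler_cvg_to diff_cvg (cvg_cst ((1 + a + B) * (1 + K * n%:R)))); apply: nearW => k.
exact: (hit_prob_diff_le_linear lambda_gt0 mu1_gt0 mu2_gt0 rates_sum
  lambda_lt_mu1 lambda_lt_mu2 b1 b_mu1 b_mu2 (ltW a0) ad1 (ltW K0) Kd B0 HB
  k Qy yn).
Qed.

Lemma exit_prob_ge (b : R) n y : 1 < b -> (0 < n)%N ->
  mu1 < lambda * b \/ mu2 < lambda * b ->
  quadrant y -> y.1 + y.2 <= n%:Z ->
  b ^ y.1 - 1 <= b ^+ n * exit_prob P xi y n.
Proof.
move=> b1 n0 [b_mu1|b_mu2] Qy yn.
  exact: (hit_prob_lim_lower1 lambda_gt0 mu1_gt0 mu2_gt0 rates_sum b1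
    b_mu1 Qy yn (exit_prob_cvg rates_sum xi_iid (y := y) n0)).
apply: le_trans (hit_prob_lim_lower2 lambda_gt0 mu1_gt0 mu2_gt0 rates_sum b1
    b_mu2 Qy yn (exit_prob_cvg rates_sum xi_iid (y := y) n0)).
by rewrite lerD2r ler_weXz2l ?(ltW b1) // lerDl; case: Qy.
Qed.

End Bounds.

Lemma scaled_start_bounds (R : realType) (x : R * R) n :
  0 <= x.1 -> 0 <= x.2 -> x.1 + x.2 < 1 ->
  [/\ quadrant (scaled_start x n),
      (scaled_start x n).1 + (scaled_start x n).2 <= n%:Z &
      n%:R * x.1 - 1 <= (scaled_start x n).1%:~R].
Proof.
move=> x1 x2 xs; split; first by split; rewrite floor_ge0 mulr_ge0.
  rewrite -(ler_int R) rmorphD /=.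
  apply: le_trans (lerD (floor_le_tmp _) (floor_le_tmp _)) _.
  by rewrite -mulrDr ler_piMr // ltW.
by rewrite lerBlDr ltW //; have := floorD1_gt (n%:R * x.1); rewrite rmorphD.
Qed.

Theorem proposition7p1 (R : realType) (d : measure_display)
    (Omega : measurableType d) (P : probability Omega R)
    (lambda mu1 mu2 : R) (xi : nat -> Omega -> lattice) (x : R * R)
    (lambda_gt0 : 0 < lambda) (mu1_gt0 : 0 < mu1) (mu2_gt0 : 0 < mu2)
    (rates_sum : lambda + mu1 + mu2 = 1)
    (xi_iid : iid_tandem_increments P lambda mu1 mu2 xi)
    (lambda_lt_mu1 : lambda < mu1) (lambda_lt_mu2 : lambda < mu2)
    (x1_ge0 : 0 <= x.1) (x2_ge0 : 0 <= x.2)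
    (x_sum : 0 < x.1 + x.2 < 1) (x1_gt0 : 0 < x.1) :
  exists2 c : R, 0 < c &
    \forall n \near \oo,
      relative_error P xi (scaled_start x n) n <= expR (- c * n%:R).
Proof.
have /andP[_ xs1] := x_sum.
set alpha := x.1 / 2.
have alpha0 : 0 < alpha by rewrite divr_gt0.
have alpha1 : alpha < 1 by rewrite /alpha; lra.
(* [b0] is the critical base separating the upper from the lower bound; the
   logarithms [beta] and [beta'] approximate its logarithm [L] from both sides. *)
set b0 := Num.min mu1 mu2 / lambda.
have b0_gt1 : 1 < b0 by rewrite ltr_pdivlMr // mul1r lt_min lambda_lt_mu1.
set L := ln b0; have L0 : 0 < L by rewrite ln_gt0.
have b0E : expR L = b0 by rewrite lnK // posrE (lt_trans _ b0_gt1).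
(* The offset [alpha / 4] keeps [beta - beta' * (1 - alpha)] at or above [L * alpha / 2],
   half of which absorbs the affine factor and half of which is the rate [c]. *)
set beta := L * (1 - alpha / 4); set beta' := L * (1 + alpha / 4).
have beta_gt0 : 0 < beta by rewrite mulr_gt0 //; lra.
have beta'_gt0 : 0 < beta' by rewrite mulr_gt0 //; lra.
have b1 : 1 < expR beta by rewrite expR_gt1.
have b'1 : 1 < expR beta' by rewrite expR_gt1.
have b_lt : expR beta < b0.
  by rewrite -b0E ltr_expR /beta gtr_pMr //; lra.
have b'_gt : b0 < expR beta'.
  by rewrite -b0E ltr_expR /beta' ltr_pMr //; lra.
have lb0 : lambda * b0 = Num.min mu1 mu2 by rewrite /b0 mulrCA divff ?mulr1 // gt_eqF.
have lb_lt : lambda * expR beta < Num.min mu1 mu2 by rewrite -lb0 ltr_pM2l.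
have lb'_gt : Num.min mu1 mu2 < lambda * expR beta' by rewrite -lb0 ltr_pM2l.
have [lb_mu1 lb_mu2] : lambda * expR beta < mu1 /\ lambda * expR beta < mu2.
  by apply/andP; rewrite -lt_min.
have lb'_mu : mu1 < lambda * expR beta' \/ mu2 < lambda * expR beta'.
  by apply/orP; rewrite -gt_min.
have [C [K [C0 K0 diff_le]]] := exit_prob_diff_le lambda_gt0 mu1_gt0 mu2_gt0
  rates_sum xi_iid lambda_lt_mu1 lambda_lt_mu2 b1 lb_mu1 lb_mu2.
set c := L * alpha / 4; have c0 : 0 < c by rewrite divr_gt0 // mulr_gt0.
exists c => //; near=> n.
have n0 : (0 < n)%N by near: n; exact: nbhs_infty_gt.
set y := scaled_start x n.
have [Qy yn y1] := scaled_start_bounds n x1_ge0 x2_ge0 xs1.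
rewrite -/y in Qy yn y1.
have y1_ge : alpha * n%:R <= y.1%:~R.
  apply: le_trans y1.
  have : 1 <= alpha * n%:R.
    rewrite mulrC -ler_pdivrMr //; near: n; exact: nbhs_infty_ger.
  by rewrite /alpha; lra.
set p := exit_prob P xi y n; set pbar := exit_prob_bar P xi y n.
have diff : `|p - pbar| <= expR (- (beta * n%:R)) * (C * (1 + K * n%:R)).
  rewrite expRN ler_pdivlMl ?expR_gt0 // mulrC [beta * _]mulrC expRM_natl mulrC.
  exact: diff_le.
(* The factor [2] here and in [lower] comes from
   [b' ^ y.1 - 1 >= b' ^ y.1 / 2], which [big] ensures. *)
have growth : 2 * C * (1 + K * n%:R) <= expR (c * n%:R).
  by near: n; apply: affine_le_expR => //; rewrite mulr_ge0.
have big : 2 <= expR (beta' * (alpha * n%:R)).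
  have : 2 * (1 + 0 * n%:R) <= expR (beta' * alpha * n%:R).
    by near: n; apply: affine_le_expR => //; rewrite mulr_gt0.
  by rewrite mul0r addr0 mulr1 mulrA.
have lower : expR (beta' * (alpha * n%:R) - beta' * n%:R) <= 2 * p.
  have H := exit_prob_ge lambda_gt0 mu1_gt0 mu2_gt0 rates_sum xi_iid
    b'1 n0 lb'_mu Qy yn.
  rewrite expRD expRN ler_pdivrMr ?expR_gt0 // [beta' * n%:R]mulrC expRM_natl.
  rewrite -[leRHS]mulrA [X in 2 * X]mulrC.
  have : expR (beta' * (alpha * n%:R)) <= expR beta' ^ y.1.
    by rewrite expRMz ler_expR mulrC ler_wpM2r // ltW.
  by move: H big; rewrite -/p; lra.
have p0 : 0 < p by rewrite -(@pmulr_rgt0 _ 2) // (lt_le_trans _ lower) // expR_gt0.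
rewrite /relative_error -/p -/pbar ler_pdivrMr //.
apply: le_trans diff _.
rewrite -(@ler_pM2l _ 2) // [leRHS]mulrCA.
apply: le_trans (ler_wpM2l (ltW (expR_gt0 _)) lower).
rewrite -expRD mulrCA [2 * (C * _)]mulrA.
apply: le_trans (ler_wpM2l (ltW (expR_gt0 _)) growth) _.
rewrite -expRD ler_expR -subr_ge0.
rewrite [X in 0 <= X](_ : _ = L * (alpha / 2) ^+ 2 * n%:R); last first.
  by rewrite /c /beta /beta'; field.
by rewrite !mulr_ge0 ?exprn_ge0 ?(ltW L0) // divr_ge0 // ltW.
Unshelve. all: by end_near. Qed.
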